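(* Let $\mathcal{P}=\langle d;\mathcal{S},\mathcal{T},\mathcal{N};N,i,t,c,S,U,rk\rangle$ be an nPLS in $S^{1}_{2}$. Then $$T^{2}_{2}\vdash\forall x\,\exists y<2^{d(|x|)}\,[y=\mathcal{P}(x)].$$
   Context: $S^{1}_{2}$ and $T^{2}_{2}$ are Buss's bounded arithmetic theories, taken (conservatively extended) in the language with function symbols for all polynomial time computable functions together with their defining axioms; polynomial time computable predicates and functions are represented in this language. $|x|$ is the binary length of $x$. Definition (nPLS, nested Polynomial Local Search). An nPLS problem is a tuple $\mathcal{P}=\langle d;\mathcal{S},\mathcal{T},\mathcal{N};N,i,t,c,S,U,rk\rangle$ where: $d$ is a polynomial; $\mathcal{S}(x,s)$ (sources), $\mathcal{T}(x,s,t)$ (targets) and $\mathcal{N}(x,s,y,z)$ (neighborhoods) are polynomial time computable predicates; $N(x,s,y)$ (neighborhood of rank zero), $i(x)$ (initial source), $t(x,s)$ (initial target), $c(x,y)$ (cost), $S(x,s,y)$ (generated source), $U(x,s,y,z)$ (extracted result) and $rk(x,s)$ (rank) are polynomial time computable functions with natural number values. Write $\mathcal{S}(x)=\{s:\mathcal{S}(x,s)\}$ and $\mathcal{T}(x,s)=\{t:\mathcal{T}(x,s,t)\}$. The following conditions must hold for all values of the variables: 1. $s\in\mathcal{S}(x)\to|s|\le d(|x|)$, and $u\in\mathcal{T}(x,s)\to\max\{|s|,|u|\}\le d(|x|)$. 2. $y\in\mathcal{T}(x,s)\to S(x,s,y)\in\mathcal{S}(x)$. 3. $\mathcal{N}(x,s,y,z)\to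 s\in\mathcal{S}(x)\land y\in\mathcal{T}(x,s)\land z\in\mathcal{T}(x,s)$. 4. $rk(x,s)=0\to[\mathcal{N}(x,s,y,z)\leftrightarrow N(x,s,y)=z\land y\in\mathcal{T}(x,s)]$. 5. $rk(x,s)>0\land y\in\mathcal{T}(x,s)\to\mathcal{N}(x,s,y,y)\lor rk(x,S(x,s,y))<rk(x,s)$. 6. $rk(x,s)>0\land\mathcal{N}(x,S(x,s,y),z,z)\to\mathcal{N}(x,s,y,U(x,s,y,z))$. 7. $i(x)\in\mathcal{S}(x)$. 8. $s\in\mathcal{S}(x)\to t(x,s)\in\mathcal{T}(x,s)$. 9. $\mathcal{N}(x,s,y,z)\to y=z\lor c(x,y)>c(x,z)$. If all of these conditions are provable in $S^{1}_{2}$, then $\mathcal{P}$ is called an nPLS in $S^{1}_{2}$. Notation: $y=\mathcal{P}(x)$ abbreviates $\mathcal{N}(x,i(x),y,y)$. *)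

(* Defs.v *)
From Stdlib Require List.
From mathcomp Require Import all_boot all_algebra.

Set Implicit Arguments.
Unset Strict Implicit.
Unset Printing Implicit Defensive.

(* Cobham's function algebra, giving a symbol for every polynomial time
   function.  [PVrec g h0 h1 k] is the function f, recursive in its first
   argument, with
     f(0, xs)   = g(xs)
     f(2y, xs)  = min(h0(y, f(y, xs), xs), k(2y, xs))      (y <> 0)
     f(2y+1,xs) = min(h1(y, f(y, xs), xs), k(2y+1, xs)).
   Cobham's side condition f <= k is replaced by truncation at k, so that every
   code denotes a total polynomial time function and its defining axioms are
   conservative; when the side condition holds the truncation has no effect. *)
Inductive pvfun : nat -> Type :=
| PVzero : pvfun 0
| PVsucc : pvfun 1
| PVhalf : pvfun 1
| PVlen : pvfun 1
| PVadd : pvfun 2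
| PVmul : pvfun 2
| PVsmash : pvfun 2
| PVproj n (i : 'I_n) : pvfun n
| PVcomp m n (f : pvfun m) (g : 'I_m -> pvfun n) : pvfun n
| PVrec n (g : pvfun n) (h0 h1 : pvfun n.+2) (k : pvfun n.+1) : pvfun n.+1.

(* Variables are de Bruijn indices. *)
Inductive term : Type :=
| Var (i : nat)
| Func n (f : pvfun n) (ts : 'I_n -> term).

Inductive form : Type :=
| Bot
| Eq (s t : term)
| Le (s t : term)
| Imp (A B : form)
| And (A B : form)
| Or (A B : form)
| All (A : form)
| Ex (A : form).

Definition app n (f : pvfun n) (ts : n.-tuple term) : term := Func f (tnth ts).

Declare Scope fo_scope.
Delimit Scope fo_scope with FO.
Bind Scope fo_scope with term form.

Notation "0" := (app PVzero [tuple]) : fo_scope.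
Notation "x .+1" := (app PVsucc [tuple x]) : fo_scope.
Notation "1" := (0.+1)%FO : fo_scope.
Notation "2" := (0.+1.+1)%FO : fo_scope.
Notation "x ./2" := (app PVhalf [tuple x]) : fo_scope.
Notation "`| x |" := (app PVlen [tuple x]) : fo_scope.
Notation "x + y" := (app PVadd [tuple x; y]) : fo_scope.
Notation "x * y" := (app PVmul [tuple x; y]) : fo_scope.
Notation "x # y" := (app PVsmash [tuple x; y])
  (at level 40, left associativity) : fo_scope.
Notation "x == y" := (Eq x y) : fo_scope.
Notation "x <= y" := (Le x y) : fo_scope.
Notation "x < y" := (Le (x.+1)%FO y) : fo_scope.
Notation "A -> B" := (Imp A B) : fo_scope.
Notation "~ A" := (Imp A Bot) : fo_scope.
Notation "x != y" := (Imp (Eq x y) Bot) : fo_scope.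
Notation "A /\ B" := (And A B) : fo_scope.
Notation "A \/ B" := (Or A B) : fo_scope.
Notation "A <-> B" := (And (Imp A B) (Imp B A)) : fo_scope.

Fixpoint tsubst (sg : nat -> term) (t : term) : term :=
  match t with
  | Var i => sg i
  | Func _ f ts => Func f (fun i => tsubst sg (ts i))
  end.

Definition tshift : term -> term := tsubst (fun i => Var i.+1).

Definition scons (t : term) (sg : nat -> term) (i : nat) : term :=
  if i is j.+1 then sg j else t.

Definition up (sg : nat -> term) : nat -> term :=
  scons (Var 0) (fun i => tshift (sg i)).

Fixpoint fsubst (sg : nat -> term) (A : form) : form :=
  match A with
  | Bot => Bot
  | Eq s t => Eq (tsubst sg s) (tsubst sg t)
  | Le s t => Le (tsubst sg s) (tsubst sg t)
  | Imp A B => Imp (fsubst sg A) (fsubst sg B)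
  | And A B => And (fsubst sg A) (fsubst sg B)
  | Or A B => Or (fsubst sg A) (fsubst sg B)
  | All A => All (fsubst (up sg) A)
  | Ex A => Ex (fsubst (up sg) A)
  end.

Definition fshift : form -> form := fsubst (fun i => Var i.+1).
Definition inst (A : form) (t : term) : form := fsubst (scons t Var) A.

(* The axioms of a theory may have free variables and stand for their universal
   closures: in [AllI] and [ExE] only the context is shifted. *)
Definition theory := form -> Prop.

(* Classical natural deduction with equality. *)
Inductive prv (T : theory) : seq form -> form -> Prop :=
| Thy G A : T A -> prv T G A
| Hyp G A : List.In A G -> prv T G A
| RAA G A : prv T ((~ A)%FO :: G) Bot -> prv T G A
| ImpI G A B : prv T (A :: G) B -> prv T G (Imp A B)
| ImpE G A B : prv T G (Imp A B) -> prv T G A -> prv T G B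
| AndI G A B : prv T G A -> prv T G B -> prv T G (And A B)
| AndE1 G A B : prv T G (And A B) -> prv T G A
| AndE2 G A B : prv T G (And A B) -> prv T G B
| OrI1 G A B : prv T G A -> prv T G (Or A B)
| OrI2 G A B : prv T G B -> prv T G (Or A B)
| OrE G A B C :
    prv T G (Or A B) -> prv T (A :: G) C -> prv T (B :: G) C -> prv T G C
| AllI G A : prv T (map fshift G) A -> prv T G (All A)
| AllE G A t : prv T G (All A) -> prv T G (inst A t)
| ExI G A t : prv T G (inst A t) -> prv T G (Ex A)
| ExE G A C :
    prv T G (Ex A) -> prv T (A :: map fshift G) (fshift C) -> prv T G C
| EqRefl G t : prv T G (Eq t t)
| EqSubst G A s t : prv T G (Eq s t) -> prv T G (inst A s) -> prv T G (inst A t).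

Definition provable (T : theory) (A : form) : Prop := prv T [::] A.

(* The 32 axioms of Buss's BASIC, in his order. *)
Definition BASIC : seq form :=
  let x := Var 0 in let y := Var 1 in let z := Var 2 in
  let u := Var 3 in let v := Var 4 in
  [:: (y <= x -> y <= x.+1)%FO;
      (x != x.+1)%FO;
      (0 <= x)%FO;
      (x <= y /\ x != y <-> x.+1 <= y)%FO;
      (x != 0 -> 2 * x != 0)%FO;
      (y <= x \/ x <= y)%FO;
      (x <= y /\ y <= x -> x == y)%FO;
      (x <= y /\ y <= z -> x <= z)%FO;
      (`|0| == 0)%FO;
      (x != 0 -> `|2 * x| == `|x|.+1 /\ `|(2 * x).+1| == `|x|.+1)%FO;
      (`|1| == 1)%FO;
      (x <= y -> `|x| <= `|y|)%FO;
      (`|x # y| == (`|x| * `|y|).+1)%FO;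
      (0 # y == 1)%FO;
      (x != 0 -> 1 # (2 * x) == 2 * (1 # x) /\
                 1 # (2 * x).+1 == 2 * (1 # x))%FO;
      (x # y == y # x)%FO;
      (`|x| == `|y| -> x # z == y # z)%FO;
      (`|x| == `|u| + `|v| -> x # y == (u # y) * (v # y))%FO;
      (x <= x + y)%FO;
      (x <= y /\ x != y -> (2 * x).+1 <= 2 * y /\ (2 * x).+1 != 2 * y)%FO;
      (x + y == y + x)%FO;
      (x + 0 == x)%FO;
      (x + y.+1 == (x + y).+1)%FO;
      ((x + y) + z == x + (y + z))%FO;
      (x + y <= x + z <-> y <= z)%FO;
      (x * 0 == 0)%FO;
      (x * y.+1 == x * y + x)%FO;
      (x * y == y * x)%FO;
      (x * (y + z) == x * y + x * z)%FO;
      (1 <= x -> (x * y <= x * z <-> y <= z))%FO;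
      (x != 0 -> `|x| == `|x./2|.+1)%FO;
      (x == y./2 <-> 2 * x == y \/ (2 * x).+1 == y)%FO].

Definition is_min (r s t : term) : form :=
  ((s <= t -> r == s) /\ (t <= s -> r == t))%FO.

(* Defining axioms of the remaining symbols. *)
Inductive PVdef : theory :=
| PVdef_proj n (i : 'I_n) :
    let xs := [tuple Var j | j < n] in
    PVdef (app (PVproj i) xs == Var i)%FO
| PVdef_comp m n (f : pvfun m) (g : 'I_m -> pvfun n) :
    let xs := [tuple Var j | j < n] in
    PVdef (app (PVcomp f g) xs == app f [tuple app (g i) xs | i < m])%FO
| PVdef_rec0 n (g : pvfun n) (h0 h1 : pvfun n.+2) (k : pvfun n.+1) :
    let f := PVrec g h0 h1 k in
    let xs := [tuple Var j.+1 | j < n] in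
    PVdef (app f [tuple of 0%FO :: xs] == app g xs)%FO
| PVdef_rec_even n (g : pvfun n) (h0 h1 : pvfun n.+2) (k : pvfun n.+1) :
    let f := PVrec g h0 h1 k in
    let y := Var 0 in
    let xs := [tuple Var j.+1 | j < n] in
    PVdef (y != 0 ->
           is_min (app f [tuple of (2 * y)%FO :: xs])
                  (app h0 [tuple of y :: app f [tuple of y :: xs] :: xs])
                  (app k [tuple of (2 * y)%FO :: xs]))%FO
| PVdef_rec_odd n (g : pvfun n) (h0 h1 : pvfun n.+2) (k : pvfun n.+1) :
    let f := PVrec g h0 h1 k in
    let y := Var 0 in
    let xs := [tuple Var j.+1 | j < n] in
    PVdef (is_min (app f [tuple of (2 * y).+1%FO :: xs])
                  (app h1 [tuple of y :: app f [tuple of y :: xs] :: xs])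
                  (app k [tuple of (2 * y).+1%FO :: xs])).

Definition bAll (t : term) (A : form) : form :=
  All (Var 0 <= tshift t -> A)%FO.
Definition bEx (t : term) (A : form) : form :=
  Ex (Var 0 <= tshift t /\ A)%FO.

Inductive sharply_bounded : form -> Prop :=
| sb_Bot : sharply_bounded Bot
| sb_Eq s t : sharply_bounded (Eq s t)
| sb_Le s t : sharply_bounded (Le s t)
| sb_Imp A B : sharply_bounded A -> sharply_bounded B -> sharply_bounded (Imp A B)
| sb_And A B : sharply_bounded A -> sharply_bounded B -> sharply_bounded (And A B)
| sb_Or A B : sharply_bounded A -> sharply_bounded B -> sharply_bounded (Or A B)
| sb_bAll t A : sharply_bounded A -> sharply_bounded (bAll (`|t|)%FO A)
| sb_bEx t A : sharply_bounded A -> sharply_bounded (bEx (`|t|)%FO A).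

(* Buss's classes Sigma^b_i and Pi^b_i, defined simultaneously. *)
Inductive Sigmab : nat -> form -> Prop :=
| Sigmab0 A : sharply_bounded A -> Sigmab 0 A
| Sigmab_Pi i A : Pib i A -> Sigmab i.+1 A
| Sigmab_bEx i t A : Sigmab i.+1 A -> Sigmab i.+1 (bEx t A)
| Sigmab_sbAll i t A : Sigmab i.+1 A -> Sigmab i.+1 (bAll (`|t|)%FO A)
| Sigmab_And i A B : Sigmab i.+1 A -> Sigmab i.+1 B -> Sigmab i.+1 (And A B)
| Sigmab_Or i A B : Sigmab i.+1 A -> Sigmab i.+1 B -> Sigmab i.+1 (Or A B)
| Sigmab_Not i A : Pib i.+1 A -> Sigmab i.+1 (~ A)%FO
| Sigmab_Imp i A B : Pib i.+1 A -> Sigmab i.+1 B -> Sigmab i.+1 (Imp A B)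
with Pib : nat -> form -> Prop :=
| Pib0 A : sharply_bounded A -> Pib 0 A
| Pib_Sigma i A : Sigmab i A -> Pib i.+1 A
| Pib_bAll i t A : Pib i.+1 A -> Pib i.+1 (bAll t A)
| Pib_sbEx i t A : Pib i.+1 A -> Pib i.+1 (bEx (`|t|)%FO A)
| Pib_And i A B : Pib i.+1 A -> Pib i.+1 B -> Pib i.+1 (And A B)
| Pib_Or i A B : Pib i.+1 A -> Pib i.+1 B -> Pib i.+1 (Or A B)
| Pib_Not i A : Sigmab i.+1 A -> Pib i.+1 (~ A)%FO
| Pib_Imp i A B : Sigmab i.+1 A -> Pib i.+1 B -> Pib i.+1 (Imp A B).

(* In [IND] and [PIND] the induction variable of A is Var 0; [at_var0 A t] is
   A with it replaced by t, staying in the scope of the quantifier. *)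
Definition at_var0 (A : form) (t : term) : form :=
  fsubst (scons t (fun i => Var i.+1)) A.

Definition IND (A : form) : form :=
  (inst A 0 /\ All (A -> at_var0 A (Var 0).+1) -> All A)%FO.

Definition PIND (A : form) : form :=
  (inst A 0 /\ All (at_var0 A (Var 0)./2 -> A) -> All A)%FO.

(* S^i_2 and T^i_2 over the language with all polynomial time symbols. *)
Inductive S2 (i : nat) : theory :=
| S2_BASIC A : List.In A BASIC -> S2 i A
| S2_PV A : PVdef A -> S2 i A
| S2_PIND A : Sigmab i A -> S2 i (PIND A).

Inductive T2 (i : nat) : theory :=
| T2_BASIC A : List.In A BASIC -> T2 i A
| T2_PV A : PVdef A -> T2 i A
| T2_IND A : Sigmab i A -> T2 i (IND A).

(* A symbol R used as a predicate holds where it takes the value 1. *)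
Definition holds n (R : pvfun n) (ts : n.-tuple term) : form := (app R ts == 1)%FO.

Definition numeral (n : nat) : term := iter n (fun t => t.+1)%FO 0%FO.

(* The term d(|x|), by Horner's rule on the coefficients of d. *)
Definition poly_len (d : {poly nat}) (x : term) : term :=
  foldr (fun c e => numeral c + `|x| * e)%FO 0%FO d.

(* The term 2^(d(|x|)): if e = 2^m then |e./2| = m, hence
   2^c * (e./2 # x) = 2^(c + |x| * m). *)
Definition exp_poly_len (d : {poly nat}) (x : term) : term :=
  foldr (fun c e => numeral (2 ^ c) * (e./2 # x))%FO 1%FO d.

Record nPLS : Type := NPLS {
  bound : {poly nat};      (* d *)
  source : pvfun 2;        (* calligraphic S(x, s) *)
  target : pvfun 3;        (* calligraphic T(x, s, t) *)
  neighbor : pvfun 4;      (* calligraphic N(x, s, y, z) *)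
  nbh0 : pvfun 3;          (* N(x, s, y) *)
  init_source : pvfun 1;   (* i(x) *)
  init_target : pvfun 2;   (* t(x, s) *)
  cost : pvfun 2;          (* c(x, y) *)
  gen_source : pvfun 3;    (* S(x, s, y) *)
  extract : pvfun 4;       (* U(x, s, y, z) *)
  rank : pvfun 2           (* rk(x, s) *)
}.

Definition conditions (P : nPLS) : seq form :=
  let x := Var 0 in let s := Var 1 in let y := Var 2 in let z := Var 3 in
  let Src a b := holds (source P) [tuple a; b] in
  let Tgt a b c := holds (target P) [tuple a; b; c] in
  let Nbr a b c e := holds (neighbor P) [tuple a; b; c; e] in
  let rk a b := app (rank P) [tuple a; b] in
  let c a b := app (cost P) [tuple a; b] in
  let S_xsy := app (gen_source P) [tuple x; s; y] in
  let d_x := poly_len (bound P) x in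
  [:: (Src x s -> `|s| <= d_x)%FO;
      (Tgt x s y -> `|s| <= d_x /\ `|y| <= d_x)%FO;
      (Tgt x s y -> Src x S_xsy)%FO;
      (Nbr x s y z -> Src x s /\ Tgt x s y /\ Tgt x s z)%FO;
      (rk x s == 0 ->
       (Nbr x s y z <-> app (nbh0 P) [tuple x; s; y] == z /\ Tgt x s y))%FO;
      (0 < rk x s /\ Tgt x s y -> Nbr x s y y \/ rk x S_xsy < rk x s)%FO;
      (0 < rk x s /\ Nbr x S_xsy z z ->
       Nbr x s y (app (extract P) [tuple x; s; y; z]))%FO;
      Src x (app (init_source P) [tuple x]);
      (Src x s -> Tgt x s (app (init_target P) [tuple x; s]))%FO;
      (Nbr x s y z -> y == z \/ c x z < c x y)%FO].

Definition nPLS_in (T : theory) (P : nPLS) : Prop :=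
  forall A, List.In A (conditions P) -> provable T A.

(* The formula y = P(x). *)
Definition solves (P : nPLS) (x y : term) : form :=
  holds (neighbor P) [tuple x; app (init_source P) [tuple x]; y; y].

(* Main.v *)
From Stdlib Require Import FunctionalExtensionality.
From Stdlib Require List.
Require Import Defs.
From mathcomp Require Import all_boot all_algebra.

(** Call a source s unsolvable if no y satisfies N(x,s,y,y).

    An unsolvable source s admits an unsolvable source of smaller rank.
    Otherwise every target y of s has a cheaper one, so that no target can have
    minimal cost, although s has a target.  Indeed:
    - if rk(x,s) = 0, the cheaper target is N(x,s,y), a neighbor of y;
    - if rk(x,s) > 0, then S(x,s,y) has smaller rank, as N(x,s,y,y) fails; it
      is thus solved by some z, and U(x,s,y,z) is a neighbor of y.
    A neighbor of y is y itself or is cheaper than y, and it is not y because s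
    is unsolvable.  So if i(x) were unsolvable, the ranks of the unsolvable
    sources would have no minimum.

    Both minimizations are instances of [prv_descent]: no nonempty bounded set
    defined by a Sigma^b_(i+1) formula is closed under decreasing a given term,
    in T^(i+1)_2.  Targets form a polynomial time set, while being an unsolvable
    source is Pi^b_1, hence Sigma^b_2; this is where T^2_2 is used.  The same
    principle with the length of the argument as the decreasing term yields
    PIND ([prv_PIND]), so that T^2_2 contains S^1_2 and proves the conditions on
    the nested PLS problem.  That a value of length at most d(|x|) lies below
    2^d(|x|) comes from computing the length of the latter term from the axioms
    on smash ([prv_len_exp_poly_len]).

    Derivations are built in the calculus itself.  Formulas with free variables
    are moved under binders by substitutions with a computable normal form
    ([fo_norm]), and theorems are instantiated at arbitrary terms ([prv_inst]),
    so that the axioms become rules on arbitrary terms. *)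

Set Implicit Arguments.
Unset Strict Implicit.
Unset Printing Implicit Defensive.

(* Substitution is to stop at [app], whose unfolding would expose a function on
   ordinals where a tuple of terms is wanted. *)
Arguments app : simpl never.
Arguments tsubst : simpl never.

(** * Substitution *)

Lemma tsubst_var sg i : tsubst sg (Var i) = sg i.
Proof. by []. Qed.

Lemma tsubst_app n sg (f : pvfun n) (ts : n.-tuple term) :
  tsubst sg (app f ts) = app f (map_tuple (tsubst sg) ts).
Proof.
rewrite /app /tsubst -/(tsubst sg); congr Func.
by apply: functional_extensionality => i; rewrite tnth_map.
Qed.

Lemma tsubst_app0 sg (f : pvfun 0) :
  tsubst sg (app f [tuple]) = app f [tuple].
Proof. by rewrite tsubst_app; congr app; apply: val_inj. Qed.

Lemma tsubst_app1 sg (f : pvfun 1) a :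
  tsubst sg (app f [tuple a]) = app f [tuple tsubst sg a].
Proof. by rewrite tsubst_app; congr app; apply: val_inj. Qed.

Lemma tsubst_app2 sg (f : pvfun 2) a b :
  tsubst sg (app f [tuple a; b]) = app f [tuple tsubst sg a; tsubst sg b].
Proof. by rewrite tsubst_app; congr app; apply: val_inj. Qed.

Lemma tsubst_app3 sg (f : pvfun 3) a b c :
  tsubst sg (app f [tuple a; b; c]) =
  app f [tuple tsubst sg a; tsubst sg b; tsubst sg c].
Proof. by rewrite tsubst_app; congr app; apply: val_inj. Qed.

Lemma tsubst_app4 sg (f : pvfun 4) a b c d :
  tsubst sg (app f [tuple a; b; c; d]) =
  app f [tuple tsubst sg a; tsubst sg b; tsubst sg c; tsubst sg d].
Proof. by rewrite tsubst_app; congr app; apply: val_inj. Qed.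

Lemma tsubst_numeral sg n : tsubst sg (numeral n) = numeral n.
Proof. by elim: n => [|n IH] /=; rewrite ?tsubst_app0 // tsubst_app1 IH. Qed.

Lemma tsubst_exp sg d x :
  tsubst sg (exp_poly_len d x) = exp_poly_len d (tsubst sg x).
Proof.
rewrite /exp_poly_len; elim: (d : seq nat) => [|c s IH] /=.
  by rewrite tsubst_app1 tsubst_app0.
by rewrite tsubst_app2 tsubst_numeral tsubst_app2 tsubst_app1 IH.
Qed.

Lemma tsubst_poly_len sg d x :
  tsubst sg (poly_len d x) = poly_len d (tsubst sg x).
Proof.
rewrite /poly_len; elim: (d : seq nat) => [|c s IH] /=.
  by rewrite tsubst_app0.
by rewrite tsubst_app2 tsubst_numeral tsubst_app2 tsubst_app1 IH.
Qed.

Definition substE := (tsubst_var, tsubst_app0, tsubst_app1, tsubst_app2,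
  tsubst_app3, tsubst_app4, tsubst_exp, tsubst_poly_len).

(** Weakening by k variables.  With it, every environment that arises has the
    form [scons t1 (scons t2 (.. (wk k)))], so that equality of substituted
    formulas becomes syntactic once compositions are evaluated. *)
Definition wk (k i : nat) : term := Var (iter k succn i).

Definition comp (sg tau : nat -> term) (i : nat) : term := tsubst sg (tau i).

Lemma tsubst_comp sg tau t :
  tsubst sg (tsubst tau t) = tsubst (comp sg tau) t.
Proof.
elim: t => [i|n f ts IH] //.
rewrite /tsubst -/(tsubst _); congr Func.
by apply: functional_extensionality => i; apply: IH.
Qed.

Lemma tsubst_wk0 t : tsubst (wk 0) t = t.
Proof.
elim: t => [i|n f ts IH] //.
rewrite /tsubst -/(tsubst _); congr Func.
by apply: functional_extensionality => i; apply: IH.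
Qed.

Lemma env_ext (sg tau : nat -> term) :
  sg 0 = tau 0 -> (forall i, sg i.+1 = tau i.+1) -> sg = tau.
Proof. by move=> e0 eS; apply: functional_extensionality => -[|i]. Qed.

Lemma comp_scons sg t tau :
  comp sg (scons t tau) = scons (tsubst sg t) (comp sg tau).
Proof. exact: env_ext. Qed.

Lemma comp_wk0 sg : comp sg (wk 0) = sg.
Proof. by []. Qed.

Lemma comp_0wk sg : comp (wk 0) sg = sg.
Proof.
by apply: functional_extensionality => i; rewrite /comp tsubst_wk0.
Qed.

Lemma comp_scons_wk t sg k : comp (scons t sg) (wk k.+1) = comp sg (wk k).
Proof. by []. Qed.

Lemma comp_wk j k : comp (wk j) (wk k) = wk (iter k succn j).
Proof.
apply: functional_extensionality => i; rewrite /comp /wk tsubst_var.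
elim: k j => //= k IH j; congr Var; case: (IH j) => <-.
by elim: j {IH} => //= j ->.
Qed.

Lemma compA sg tau rho : comp (comp sg tau) rho = comp sg (comp tau rho).
Proof.
by apply: functional_extensionality => i; rewrite /comp tsubst_comp.
Qed.

Lemma scons_wk k : scons (Var k) (wk k.+1) = wk k.
Proof.
apply: env_ext => [|i]; rewrite /wk /=.
  by congr Var; elim: k => //= k {1}->.
by congr Var; elim: k => //= k ->.
Qed.

Lemma upE sg : up sg = scons (Var 0) (comp (wk 1) sg).
Proof. by []. Qed.

Lemma up_comp sg tau : comp (up sg) (up tau) = up (comp sg tau).
Proof. by rewrite !upE comp_scons -!compA comp_scons_wk comp_wk0. Qed.

Lemma fsubst_comp sg tau A :
  fsubst sg (fsubst tau A) = fsubst (comp sg tau) A.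
Proof.
by elim: A sg tau => //= [s t|s t|A IA B IB|A IA B IB|A IA B IB|A IA|A IA]
  sg tau; rewrite ?tsubst_comp ?IA ?IB ?up_comp.
Qed.

Lemma fsubst_wk0 A : fsubst (wk 0) A = A.
Proof.
by elim: A => //= [s t|s t|A -> B ->|A -> B ->|A -> B ->|A IA|A IA];
  rewrite ?tsubst_wk0 ?upE ?comp_wk0 ?scons_wk ?IA.
Qed.

Lemma fsubstE sg :
  (fsubst sg Bot = Bot)
  * (forall s t, fsubst sg (Eq s t) = Eq (tsubst sg s) (tsubst sg t))
  * (forall s t, fsubst sg (Le s t) = Le (tsubst sg s) (tsubst sg t))
  * (forall A B, fsubst sg (Imp A B) = Imp (fsubst sg A) (fsubst sg B))
  * (forall A B, fsubst sg (And A B) = And (fsubst sg A) (fsubst sg B))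
  * (forall A B, fsubst sg (Or A B) = Or (fsubst sg A) (fsubst sg B))
  * (forall A, fsubst sg (All A) =
               All (fsubst (scons (Var 0) (comp (wk 1) sg)) A))
  * (forall A, fsubst sg (Ex A) =
               Ex (fsubst (scons (Var 0) (comp (wk 1) sg)) A)).
Proof. by []. Qed.

Lemma foE :
  (forall t, tshift t = tsubst (wk 1) t)
  * (forall A, fshift A = fsubst (wk 1) A)
  * (forall A t, inst A t = fsubst (scons t (wk 0)) A)
  * (forall A t, at_var0 A t = fsubst (scons t (wk 1)) A)
  * (forall t A, bAll t A = All (Var 0 <= tsubst (wk 1) t -> A)%FO)
  * (forall t A, bEx t A = Ex (Var 0 <= tsubst (wk 1) t /\ A)%FO).
Proof. by []. Qed.

Lemma fsubst_bAll sg t A :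
  fsubst sg (bAll t A) = bAll (tsubst sg t) (fsubst (up sg) A).
Proof. by rewrite !foE !fsubstE !tsubst_comp. Qed.

Lemma fsubst_bEx sg t A :
  fsubst sg (bEx t A) = bEx (tsubst sg t) (fsubst (up sg) A).
Proof. by rewrite !foE !fsubstE !tsubst_comp. Qed.

Lemma sharply_bounded_subst A :
  sharply_bounded A -> forall sg, sharply_bounded (fsubst sg A).
Proof.
elim=> {A} [|s t|s t|A B _ IA _ IB|A B _ IA _ IB|A B _ IA _ IB|t A _ IA
  |t A _ IA] sg; rewrite ?fsubst_bAll ?fsubst_bEx ?substE /=; by constructor.
Qed.

Scheme Sigmab_mind := Induction for Sigmab Sort Prop
  with Pib_mind := Induction for Pib Sort Prop.

Lemma Sigmab_subst i A : Sigmab i A -> forall sg, Sigmab i (fsubst sg A).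
Proof.
move: i A.
apply: (Sigmab_mind (P0 := fun i A _ => forall sg, Pib i (fsubst sg A)));
  intros; rewrite ?fsubst_bAll ?fsubst_bEx ?substE /=.
all: by auto using Sigmab, Pib, sharply_bounded_subst.
Qed.

Lemma wkE k i : wk k i = Var (iter k succn i).
Proof. by []. Qed.

Arguments fsubst : simpl never.
Arguments tshift : simpl never.

Ltac env_norm := rewrite ?map_cons ?foE ?wkE ?substE ?fsubst_comp ?tsubst_comp
  -?compA ?comp_scons ?comp_wk0 ?comp_0wk ?comp_scons_wk ?comp_wk ?scons_wk
  ?fsubst_wk0 ?tsubst_wk0 /=.

Ltac fo_norm := repeat (progress (env_norm; rewrite ?fsubstE)).

(** * Derivations *)

Lemma cons_incl (B : Defs.form) G G' :
  List.incl G G' -> List.incl (B :: G) (B :: G').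
Proof. by move=> sub C /= [->|/sub]; [left | right]. Qed.

Lemma prv_mono T T' G A : (forall G' B, T B -> prv T' G' B) ->
  prv T G A -> forall G', List.incl G G' -> prv T' G' A.
Proof.
have map_incl G1 G2 :
    List.incl G1 G2 -> List.incl (map fshift G1) (map fshift G2).
  by move=> sub; apply: List.incl_map.
move=> TT'; elim=> [G1 B TB|G1 B inB|G1 B _ IH|G1 B C _ IH|G1 B C _ IB _ IC
  |G1 B C _ IB _ IC|G1 B C _ IH|G1 B C _ IH|G1 B C _ IH|G1 B C _ IH
  |G1 B C D _ IB _ IC _ ID|G1 B _ IH|G1 B t _ IH|G1 B t _ IH
  |G1 B C _ IB _ IC|G1 t|G1 B s t _ IB _ IC] G' sub.
- exact: TT'.
- exact/Hyp/sub.
- exact/RAA/IH/cons_incl.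
- exact/ImpI/IH/cons_incl.
- exact: ImpE (IB _ sub) (IC _ sub).
- exact: AndI (IB _ sub) (IC _ sub).
- exact: AndE1 (IH _ sub).
- exact: AndE2 (IH _ sub).
- exact: OrI1 (IH _ sub).
- exact: OrI2 (IH _ sub).
- by apply: OrE (IB _ sub) (IC _ _) (ID _ _); apply: cons_incl.
- exact/AllI/IH/map_incl.
- exact: AllE (IH _ sub).
- exact: ExI (IH _ sub).
- by apply: ExE (IB _ sub) (IC _ _); apply/cons_incl/map_incl.
- exact: EqRefl.
- exact: EqSubst (IB _ sub) (IC _ sub).
Qed.

Lemma prv_weaken T G G' A : List.incl G G' -> prv T G A -> prv T G' A.
Proof. by move=> sub d; apply: prv_mono d _ sub => ? ?; apply: Thy. Qed.

Lemma prv_weaken1 T G A B : prv T G A -> prv T (B :: G) A.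
Proof. by apply: prv_weaken => C inC; right. Qed.

Lemma prv_nil T G A : prv T [::] A -> prv T G A.
Proof. by apply: prv_weaken => B []. Qed.

Lemma prv_theory T T' G A :
  (forall B, T B -> prv T' [::] B) -> prv T G A -> prv T' G A.
Proof.
by move=> TT' /prv_mono; apply=> // G' B /TT'; apply: prv_nil.
Qed.

Lemma prv_hyp0 T G A : prv T (A :: G) A.
Proof. by apply: Hyp; left. Qed.

Lemma prv_hyp T G n : n < size G -> prv T G (nth Bot G n).
Proof.
move=> ltn; apply: Hyp.
by elim: G n ltn => //= A s IH [|n] ltn; [left | right; apply: IH].
Qed.

Ltac hyp n :=
  match goal with |- context [prv ?T ?G _] =>
    have /= := @prv_hyp T G n isT end.

Ltac lift d := solve [repeat (first [exact: d | apply: prv_weaken1])].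

Lemma prv_cut T G A B : prv T G A -> prv T (A :: G) B -> prv T G B.
Proof. by move=> dA dB; apply: ImpE dA; apply: ImpI. Qed.

Definition env (ts : seq term) : nat -> term := foldr scons (wk 0) ts.

(** The axioms of a theory need not be closed under substitution, so a theorem
    is instantiated through its universal closure, which the empty context
    allows. *)
Lemma prv_inst T G A ts : prv T [::] A -> prv T G (fsubst (env ts) A).
Proof.
move=> dA; apply: prv_nil.
have {dA} : prv T [::] (iter (size ts) All A).
  by elim: (size ts) => [|n IH]; [exact: dA|]; apply: AllI; exact: IH.
elim: ts A => [|t ts IH] A; first by rewrite fsubst_wk0.
rewrite /= -iterS iterSr => /IH /AllE - /(_ t).
by fo_norm.
Qed.

Lemma prv_false T G A : prv T G Bot -> prv T G A.
Proof. by move=> d; apply/RAA/prv_weaken1. Qed.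

Lemma prv_cases T G A B C :
  prv T G (A \/ B) -> prv T G (A -> C) -> prv T G (B -> C) -> prv T G C.
Proof.
move=> dAB dA dB; apply: OrE dAB _ _.
  exact: ImpE (prv_weaken1 _ dA) (prv_hyp0 _ _ _).
exact: ImpE (prv_weaken1 _ dB) (prv_hyp0 _ _ _).
Qed.

Lemma prv_eq_fsubst T G A a b sg :
  prv T G (a == b) -> prv T G (fsubst (scons a sg) A) ->
  prv T G (fsubst (scons b sg) A).
Proof.
move=> /(EqSubst (A := fsubst (scons (Var 0) (comp (wk 1) sg)) A)).
by fo_norm.
Qed.

Ltac eq_rewrite A ts ab :=
  have := prv_eq_fsubst (A := A) (sg := env ts) ab; rewrite /env /=; fo_norm.

Lemma prv_eq_sym T G a b : prv T G (a == b) -> prv T G (b == a).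
Proof.
by move=> ab; eq_rewrite (Var 0 == Var 1)%FO [:: a] ab; apply; apply: EqRefl.
Qed.

Lemma prv_eq_trans T G a b c :
  prv T G (a == b) -> prv T G (b == c) -> prv T G (a == c).
Proof. by move=> ab bc; eq_rewrite (Var 1 == Var 0)%FO [:: a] bc; apply. Qed.

Ltac etrans t := apply: (@prv_eq_trans _ _ _ t).

Lemma prv_eq_congr1 T G (f : pvfun 1) a b :
  prv T G (a == b) -> prv T G (app f [tuple a] == app f [tuple b]).
Proof.
move=> ab; eq_rewrite (app f [tuple Var 1] == app f [tuple Var 0])%FO [:: a] ab.
by apply; apply: EqRefl.
Qed.

Lemma prv_eq_congr2 T G (f : pvfun 2) a b c d :
  prv T G (a == b) -> prv T G (c == d) ->
  prv T G (app f [tuple a; c] == app f [tuple b; d]).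
Proof.
move=> ab cd; etrans (app f [tuple b; c])%FO.
  eq_rewrite (app f [tuple Var 1; Var 2] == app f [tuple Var 0; Var 2])%FO
    [:: a; c] ab.
  by apply; apply: EqRefl.
eq_rewrite (app f [tuple Var 1; Var 2] == app f [tuple Var 1; Var 0])%FO
  [:: b; c] cd.
by apply; apply: EqRefl.
Qed.

Lemma prv_le_congr T G a b c d :
  prv T G (a == b) -> prv T G (c == d) -> prv T G (a <= c) -> prv T G (b <= d).
Proof.
move=> ab cd ac; eq_rewrite (Var 0 <= Var 1)%FO [:: c] ab => /(_ ac) bc.
by eq_rewrite (Var 1 <= Var 0)%FO [:: b] cd; apply.
Qed.

(** * Arithmetic from the basic axioms *)

Lemma prv_basic i G ts n :
  n < size BASIC -> prv (T2 i) G (fsubst (env ts) (nth Bot BASIC n)).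
Proof.
move=> ltn; apply/prv_inst/Thy/T2_BASIC.
elim: BASIC n ltn => //= A s IH [|n] ltn; [by left | by right; apply: IH].
Qed.

(** Axiom n of [BASIC], counted from 0, with x, y, z, u, v replaced by the terms
    [ts]. *)
Ltac basic n ts :=
  match goal with |- context [prv (T2 ?i) ?G _] =>
    have := @prv_basic i G ts n isT; rewrite /env /=; fo_norm end.

Lemma prv_le_total i G a b : prv (T2 i) G (a <= b \/ b <= a).
Proof. by basic 5 [:: b; a]. Qed.

Lemma prv_le_refl i G a : prv (T2 i) G (a <= a).
Proof. by apply: prv_cases (prv_le_total i G a a) _ _; apply/ImpI/prv_hyp0. Qed.

Lemma prv_le_trans i G a b c :
  prv (T2 i) G (a <= b) -> prv (T2 i) G (b <= c) -> prv (T2 i) G (a <= c).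
Proof. by move=> ab bc; basic 7 [:: a; b; c] => /ImpE; apply; apply: AndI. Qed.

Lemma prv_le_anti i G a b :
  prv (T2 i) G (a <= b) -> prv (T2 i) G (b <= a) -> prv (T2 i) G (a == b).
Proof. by move=> ab ba; basic 6 [:: a; b] => /ImpE; apply; apply: AndI. Qed.

Lemma prv_eq_le i G a b : prv (T2 i) G (a == b) -> prv (T2 i) G (a <= b).
Proof.
by move=> ab; apply: prv_le_congr (EqRefl _ _ _) ab (prv_le_refl _ _ _).
Qed.

Lemma prv_lt_irrefl i G a : prv (T2 i) G (a < a) -> prv (T2 i) G Bot.
Proof.
basic 3 [:: a; a] => /AndE2/ImpE ax /ax /AndE2/ImpE; apply; exact: EqRefl.
Qed.

Lemma prv_lt_le i G a b : prv (T2 i) G (a < b) -> prv (T2 i) G (a <= b).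
Proof. by basic 3 [:: a; b] => /AndE2/ImpE ax /ax /AndE1. Qed.

Lemma prv_lt_not_le i G a b :
  prv (T2 i) G (a < b) -> prv (T2 i) G (b <= a) -> prv (T2 i) G Bot.
Proof. by move=> ab ba; apply: prv_lt_irrefl (prv_le_trans ab ba). Qed.

Lemma prv_not_le_lt i G a b :
  prv (T2 i) G (~ (b <= a)) -> prv (T2 i) G (a < b).
Proof.
move=> nba; basic 3 [:: a; b] => /AndE1/ImpE; apply; apply: AndI.
  apply: prv_cases (prv_le_total _ _ a b) _ _; apply: ImpI.
    exact: prv_hyp0.
  exact/prv_false/(ImpE (prv_weaken1 _ nba))/prv_hyp0.
exact/ImpI/(ImpE (prv_weaken1 _ nba))/prv_eq_le/prv_eq_sym/prv_hyp0.
Qed.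

Lemma prv_zero_or_pos i G a : prv (T2 i) G (a == 0 \/ 0 < a)%FO.
Proof.
apply: RAA; hyp 0 => /ImpE; apply; apply/OrI2/prv_not_le_lt/ImpI.
apply: prv_false; hyp 1 => /ImpE; apply; apply: OrI1.
by apply: prv_le_anti (prv_hyp0 _ _ _) _; basic 2 [:: a].
Qed.

Lemma prv_addC i G a b : prv (T2 i) G (a + b == b + a)%FO.
Proof. by basic 20 [:: a; b]. Qed.

Lemma prv_addn0 i G a : prv (T2 i) G (a + 0 == a)%FO.
Proof. by basic 21 [:: a]. Qed.

Lemma prv_addnS i G a b : prv (T2 i) G (a + b.+1 == (a + b).+1)%FO.
Proof. by basic 22 [:: a; b]. Qed.

Lemma prv_addSn i G a b : prv (T2 i) G (a.+1 + b == (a + b).+1)%FO.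
Proof.
etrans (b + a.+1)%FO; first exact: prv_addC.
etrans ((b + a).+1)%FO; first exact: prv_addnS.
exact/prv_eq_congr1/prv_addC.
Qed.

Lemma prv_add0n i G a : prv (T2 i) G (0 + a == a)%FO.
Proof. exact: prv_eq_trans (prv_addC _ _ _ _) (prv_addn0 _ _ _). Qed.

Lemma prv_add1 i G a : prv (T2 i) G (1 + a == a.+1)%FO.
Proof.
exact: prv_eq_trans (prv_addSn _ _ _ _) (prv_eq_congr1 _ (prv_add0n _ _ _)).
Qed.

Lemma prv_le_addl i G a b : prv (T2 i) G (a <= b + a)%FO.
Proof.
apply: prv_le_congr (EqRefl _ _ _) (prv_addC _ _ a b) _.
by basic 18 [:: a; b].
Qed.

Lemma prv_succ_inj i G a b :
  prv (T2 i) G (a.+1 == b.+1)%FO -> prv (T2 i) G (a == b).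
Proof.
have le c d : prv (T2 i) G (c.+1 <= d.+1)%FO -> prv (T2 i) G (c <= d).
  move=> cd; basic 24 [:: 1%FO; c; d] => /AndE1/ImpE; apply.
  by apply: prv_le_congr cd; apply/prv_eq_sym/prv_add1.
by move=> ab; apply: prv_le_anti; apply/le/prv_eq_le => //; apply: prv_eq_sym.
Qed.

Lemma prv_add_lt_le i G a b c d :
  prv (T2 i) G (a < b)%FO -> prv (T2 i) G (b + c <= d)%FO ->
  prv (T2 i) G (a + c.+1 <= d)%FO.
Proof.
move=> ab; apply: prv_le_trans.
apply: prv_le_congr (_ : prv _ _ (c + a.+1 == _)%FO) (prv_addC _ _ c b) _.
  etrans (a.+1 + c)%FO; first exact: prv_addC.
  exact: prv_eq_trans (prv_addSn _ _ _ _) (prv_eq_sym (prv_addnS _ _ _ _)).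
by basic 24 [:: c; a.+1%FO; b] => /AndE2/ImpE; apply.
Qed.

Lemma prv_mulC i G a b : prv (T2 i) G (a * b == b * a)%FO.
Proof. by basic 27 [:: a; b]. Qed.

Lemma prv_mulnS i G a b : prv (T2 i) G (a * b.+1 == a * b + a)%FO.
Proof. by basic 26 [:: a; b]. Qed.

Lemma prv_muln1 i G a : prv (T2 i) G (a * 1 == a)%FO.
Proof.
etrans (a * 0 + a)%FO; first exact: prv_mulnS.
etrans (0 + a)%FO; last exact: prv_add0n.
by apply: prv_eq_congr2 (EqRefl _ _ _); basic 25 [:: a].
Qed.

Lemma prv_mul_double i G a b : prv (T2 i) G ((b + b) * a == 2 * (b * a))%FO.
Proof.
etrans (b * a + b * a)%FO.
  etrans (a * (b + b))%FO; first exact: prv_mulC.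
  etrans (a * b + a * b)%FO; first by basic 28 [:: a; b; b].
  by apply: prv_eq_congr2; apply: prv_mulC.
apply: prv_eq_sym; etrans (b * a * 2)%FO; first exact: prv_mulC.
etrans (b * a * 1 + b * a)%FO; first exact: prv_mulnS.
exact: prv_eq_congr2 (prv_muln1 _ _ _) (EqRefl _ _ _).
Qed.

Lemma prv_numeral_add i G m n :
  prv (T2 i) G (numeral (m + n)%N == numeral m + numeral n)%FO.
Proof.
elim: n => [|n IH]; rewrite ?addn0 ?addnS; first exact/prv_eq_sym/prv_addn0.
apply: prv_eq_trans (prv_eq_congr1 _ IH) _.
exact/prv_eq_sym/prv_addnS.
Qed.

(** * The length of the bound 2^d(|x|) *)

Lemma prv_len_neq0 i G w v :
  prv (T2 i) G (`|w| == v.+1)%FO -> prv (T2 i) G (w != 0)%FO.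
Proof.
move=> lw; apply/ImpI/(@prv_lt_not_le _ _ v 0%FO); last by basic 2 [:: v].
apply/prv_eq_le/(prv_eq_trans (prv_eq_sym (prv_weaken1 _ lw))).
etrans (`|0|)%FO; first exact/prv_eq_congr1/prv_hyp0.
by basic 8 ([::] : seq term).
Qed.

Lemma prv_len_double i G w v :
  prv (T2 i) G (`|w| == v.+1)%FO -> prv (T2 i) G (`|2 * w| == v.+1.+1)%FO.
Proof.
move=> lw; basic 9 [:: w] => /ImpE/(_ (prv_len_neq0 lw))/AndE1 e.
by apply: prv_eq_trans e (prv_eq_congr1 _ lw).
Qed.

Lemma prv_len_mul_exp i G c w v :
  prv (T2 i) G (`|w| == v.+1)%FO ->
  prv (T2 i) G (`|numeral (2 ^ c) * w| == (numeral c + v).+1)%FO.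
Proof.
move=> lw; elim: c => [|c IH].
  etrans (`|w|)%FO.
    apply: prv_eq_congr1; etrans (w * 1)%FO; first exact: prv_mulC.
    exact: prv_muln1.
  exact/(prv_eq_trans lw)/prv_eq_congr1/prv_eq_sym/prv_add0n.
rewrite expnS mul2n -addnn; etrans (`|2 * (numeral (2 ^ c) * w)|)%FO.
  apply: prv_eq_congr1; apply: prv_eq_trans (prv_mul_double _ _ _ _).
  exact: prv_eq_congr2 (prv_numeral_add _ _ _ _) (EqRefl _ _ _).
exact/(prv_eq_trans (prv_len_double IH))/prv_eq_congr1/prv_eq_sym/prv_addSn.
Qed.

(** Horner's rule is followed through the equations |a # b| = |a||b| + 1 and
    |e| = |e/2| + 1, the second of which holds for every nonzero e. *)
Lemma prv_len_exp_poly_len i G d x :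
  prv (T2 i) G (`|exp_poly_len d x| == (poly_len d x).+1)%FO.
Proof.
rewrite /exp_poly_len /poly_len; elim: (d : seq nat) => [|c s IH] /=.
  by basic 10 ([::] : seq term).
apply: prv_len_mul_exp.
set e := foldr _ _ _ in IH *; set p := foldr _ _ _ in IH *.
etrans ((`|e./2| * `|x|).+1)%FO; first by basic 12 [:: e./2%FO; x].
apply: prv_eq_congr1; etrans (p * `|x|)%FO; last exact: prv_mulC.
apply: prv_eq_congr2 (EqRefl _ _ _).
apply/prv_succ_inj/(prv_eq_trans _ IH)/prv_eq_sym.
by basic 30 [:: e] => /ImpE; apply; apply: prv_len_neq0 IH.
Qed.

Lemma prv_lt_exp_poly_len i G d x y :
  prv (T2 i) G (`|y| <= poly_len d x)%FO ->
  prv (T2 i) G (y < exp_poly_len d x)%FO.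
Proof.
move=> ly; apply/prv_not_le_lt/ImpI.
apply: prv_lt_not_le (prv_eq_le (prv_eq_sym (prv_len_exp_poly_len _ _ _ _))) _.
apply: prv_le_trans (prv_weaken1 _ ly).
by basic 11 [:: exp_poly_len d x; y] => /ImpE; apply; apply: prv_hyp0.
Qed.

(** * Bounded minimization *)

Lemma sharply_bounded_Sigmab A : sharply_bounded A ->
  forall i, Sigmab i A /\ Pib i A.
Proof.
move=> sA; elim=> [|i [IS IP]]; split.
- exact: Sigmab0.
- exact: Pib0.
- exact: Sigmab_Pi.
- exact: Pib_Sigma.
Qed.

(** Starting from an element y0 of the set D of values up to b, i steps of
    descent lead to an element y with f(y) + i <= f(y0); this bounded
    existential statement is proved by induction on i, and i = f(y0) + 1 is
    absurd.  In the last hypothesis the new element is Var 0 and the old one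
    Var 1, which D and f at the new element have to skip. *)
Lemma prv_descent i G b D f : Sigmab i.+1 D ->
  prv (T2 i.+1) G (bEx b D) ->
  prv (T2 i.+1) G (bAll b (D ->
    bEx (tshift b) (fsubst (scons (Var 0) (wk 2)) D /\
                    tsubst (scons (Var 0) (wk 2)) f < tshift f)))%FO ->
  prv (T2 i.+1) G Bot.
Proof.
move=> sD; set H := bAll _ _ => dE dH.
apply: prv_cut dH _; apply: ExE (prv_weaken1 _ dE) _.
set G1 := (_ :: _)%SEQ.
(* Here y is Var 0, i is Var 1, and y0 is Var 2. *)
pose B := bEx (tshift (tshift b))
  (fsubst (scons (Var 0) (wk 3)) D /\
   tsubst (scons (Var 0) (wk 3)) f + Var 1 <= tshift (tshift f))%FO.
have sB : Sigmab i.+1 B.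
  apply: Sigmab_bEx; apply: Sigmab_And; first exact: Sigmab_subst.
  exact: (sharply_bounded_Sigmab (sb_Le _ _) _).1.
have dB : prv (T2 i.+1) G1 (All B).
  apply: ImpE (Thy _ (T2_IND sB)) _; apply: AndI.
    rewrite /B; fo_norm; apply: (ExI (t := Var 0)).
    rewrite /G1; fo_norm; hyp 0 => y0D.
    apply/(AndI (AndE1 y0D))/(AndI (AndE2 y0D))/prv_eq_le.
    exact: prv_addn0.
  apply: AllI; apply: ImpI; rewrite /G1 /H {G1 H dE}; fo_norm.
  apply: ExE (prv_hyp0 _ _ _) _; fo_norm.
  hyp 3 => /(AllE (Var 0)); fo_norm; hyp 0 => yB.
  move=> /ImpE/(_ (AndE1 yB))/ImpE/(_ (AndE1 (AndE2 yB))) dz.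
  apply: ExE dz _; fo_norm; apply: (ExI (t := Var 0)); fo_norm.
  hyp 1 => /AndE2/AndE2; hyp 0 => zD le_y.
  apply: AndI (AndE1 zD) _; apply: AndI (AndE1 (AndE2 zD)) _.
  exact: prv_add_lt_le (AndE2 (AndE2 zD)) le_y.
have := AllE (f.+1)%FO dB; rewrite /B; fo_norm => yB; apply: ExE yB _.
rewrite /G1 /H {G1 H dE dB}; fo_norm; hyp 0 => /AndE2/AndE2 le_f.
exact: prv_lt_irrefl (prv_le_trans (prv_le_addl _ _ _ _) le_f).
Qed.

(** * Polynomial induction *)

Lemma Sigmab_neg i A : Sigmab i A -> Sigmab i.+1 (~ A)%FO.
Proof.
case: i => [|i] sA; last by apply/Sigmab_Pi/Pib_Not.
inversion sA; apply: (sharply_bounded_Sigmab _ _).1; apply: sb_Imp => //.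
exact: sb_Bot.
Qed.

Lemma prv_len_half i G a :
  prv (T2 i) G (a != 0)%FO -> prv (T2 i) G (`|a./2| < `|a|)%FO.
Proof.
move=> a0; apply/prv_eq_le/prv_eq_sym.
by basic 30 [:: a] => /ImpE; apply.
Qed.

Lemma prv_half_le i G a :
  prv (T2 i) G (a != 0)%FO -> prv (T2 i) G (a./2 <= a)%FO.
Proof.
move=> a0; apply/prv_lt_le/prv_not_le_lt/ImpI.
apply: prv_lt_not_le (prv_len_half (prv_weaken1 _ a0)) _.
by basic 11 [:: a; a./2%FO] => /ImpE; apply; apply: prv_hyp0.
Qed.

(** A counterexample to the induction is nonzero, and its half is a
    counterexample of smaller length. *)
Lemma prv_PIND i A : Sigmab i A -> prv (T2 i.+1) [::] (PIND A).
Proof.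
move=> sA; apply: ImpI; apply: AllI; apply: RAA.
pose D := (~ fsubst (scons (Var 0) (wk 2)) A)%FO.
have sD : Sigmab i.+1 D by apply/Sigmab_neg/Sigmab_subst.
apply: (prv_descent (b := Var 0) (f := `|Var 0|%FO) sD); rewrite /D {sD D}.
  fo_norm; apply: (ExI (t := Var 0)); fo_norm.
  exact: AndI (prv_le_refl _ _ _) (prv_hyp0 _ _ _).
apply: AllI; apply: ImpI; apply: ImpI; fo_norm.
match goal with |- prv _ ?G _ => have y0 : prv (T2 i.+1) G (Var 0 != 0)%FO end.
  apply: ImpI; hyp 1 => /ImpE; apply.
  by apply: prv_eq_fsubst (prv_eq_sym (prv_hyp0 _ _ _)) _; hyp 4 => /AndE1.
apply: (ExI (t := (Var 0)./2%FO)); fo_norm; apply: AndI.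
  by apply: prv_le_trans (prv_half_le y0) _; hyp 1.
apply: AndI (prv_len_half y0); apply: ImpI; hyp 1 => /ImpE; apply.
by hyp 4 => /AndE2/(AllE (Var 0)); fo_norm => /ImpE; apply; apply: prv_hyp0.
Qed.

Lemma prv_S2_T2 i G A : prv (S2 i) G A -> prv (T2 i.+1) G A.
Proof.
apply: prv_theory => B [C inC|C defC|C sC]; last exact: prv_PIND.
  exact/Thy/T2_BASIC.
exact/Thy/T2_PV.
Qed.

(** * Unsolvable sources *)

Notation Src P x s := (holds (source P) [tuple x; s]).
Notation Tgt P x s y := (holds (target P) [tuple x; s; y]).
Notation Nbr P x s y z := (holds (neighbor P) [tuple x; s; y; z]).
Notation rk P x s := (app (rank P) [tuple x; s]).
Notation cst P x y := (app (cost P) [tuple x; y]).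
Notation vbound P x := (exp_poly_len (bound P) x).

Definition unsolvable P x s : Defs.form :=
  bAll (vbound P x) (~ Nbr P (tshift x) (tshift s) (Var 0) (Var 0))%FO.

Definition has_lower_unsolvable P x s : Defs.form :=
  bEx (vbound P x)
    ((Src P (tshift x) (Var 0) /\ unsolvable P (tshift x) (Var 0)) /\
     rk P (tshift x) (Var 0) < rk P (tshift x) (tshift s))%FO.

Definition has_cheaper P x s y : Defs.form :=
  bEx (vbound P x)
    (Tgt P (tshift x) (tshift s) (Var 0) /\
     cst P (tshift x) (Var 0) < cst P (tshift x) (tshift y))%FO.

Lemma fsubst_holds2 sg R a b : fsubst sg (holds R [tuple a; b]) =
  holds R [tuple tsubst sg a; tsubst sg b].
Proof. by rewrite /holds; fo_norm. Qed.

Lemma fsubst_holds3 sg R a b e : fsubst sg (holds R [tuple a; b; e]) =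
  holds R [tuple tsubst sg a; tsubst sg b; tsubst sg e].
Proof. by rewrite /holds; fo_norm. Qed.

Lemma fsubst_holds4 sg R a b e d : fsubst sg (holds R [tuple a; b; e; d]) =
  holds R [tuple tsubst sg a; tsubst sg b; tsubst sg e; tsubst sg d].
Proof. by rewrite /holds; fo_norm. Qed.

Lemma fsubst_unsolvable sg P x s :
  fsubst sg (unsolvable P x s) = unsolvable P (tsubst sg x) (tsubst sg s).
Proof. by rewrite /unsolvable /holds; fo_norm. Qed.

Lemma fsubst_has_lower_unsolvable sg P x s :
  fsubst sg (has_lower_unsolvable P x s) =
  has_lower_unsolvable P (tsubst sg x) (tsubst sg s).
Proof. by rewrite /has_lower_unsolvable /unsolvable /holds; fo_norm. Qed.

Lemma fsubst_has_cheaper sg P x s y :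
  fsubst sg (has_cheaper P x s y) =
  has_cheaper P (tsubst sg x) (tsubst sg s) (tsubst sg y).
Proof. by rewrite /has_cheaper /holds; fo_norm. Qed.

Definition pls_substE := (fsubst_holds2, fsubst_holds3, fsubst_holds4,
  fsubst_unsolvable, fsubst_has_lower_unsolvable, fsubst_has_cheaper).

(** Substitutes without unfolding the predicates above: their rules have to come
    before [fsubstE], which matches them up to unfolding. *)
Ltac pls_norm :=
  repeat (progress (env_norm; try rewrite !pls_substE; try rewrite fsubstE)).

Lemma prv_condition P G ts n : nPLS_in (S2 1) P -> n < size (conditions P) ->
  prv (T2 2) G (fsubst (env ts) (nth Bot (conditions P) n)).
Proof.
move=> hP ltn; apply/prv_inst/prv_S2_T2/hP.
by elim: (conditions P) n ltn => //= A s IH [|n] ltn; [left | right; apply: IH].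
Qed.

(** Condition n of the problem, counted from 0, with x, s, y, z replaced by the
    terms [ts]. *)
Ltac condition hP n ts :=
  match goal with |- context [prv _ ?G _] =>
    have := @prv_condition _ G ts n hP isT; rewrite /env /=; pls_norm end.

Lemma source_lt P G x s : nPLS_in (S2 1) P ->
  prv (T2 2) G (Src P x s) -> prv (T2 2) G (s < vbound P x)%FO.
Proof.
move=> hP xs; apply: prv_lt_exp_poly_len.
by condition hP 0 [:: x; s] => /ImpE; apply.
Qed.

Lemma target_lt P G x s y : nPLS_in (S2 1) P ->
  prv (T2 2) G (Tgt P x s y) -> prv (T2 2) G (y < vbound P x)%FO.
Proof.
move=> hP xsy; apply: prv_lt_exp_poly_len.
by condition hP 1 [:: x; s; y] => /ImpE/(_ xsy)/AndE2.
Qed.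

Lemma neighbor_target P G x s y z : nPLS_in (S2 1) P ->
  prv (T2 2) G (Nbr P x s y z) -> prv (T2 2) G (Tgt P x s z).
Proof.
by move=> hP n; condition hP 3 [:: x; s; y; z] => /ImpE/(_ n)/AndE2/AndE2.
Qed.

Lemma unsolvable_false P G x s y : nPLS_in (S2 1) P ->
  prv (T2 2) G (unsolvable P x s) -> prv (T2 2) G (Nbr P x s y y) ->
  prv (T2 2) G Bot.
Proof.
move=> hP /(AllE y); pls_norm => u n.
exact: ImpE (ImpE u (prv_lt_le (target_lt hP (neighbor_target hP n)))) n.
Qed.

(** The alternative z = y would make y a solution at s. *)
Lemma neighbor_cheaper P G x s y z : nPLS_in (S2 1) P ->
  prv (T2 2) G (unsolvable P x s) -> prv (T2 2) G (Nbr P x s y z) ->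
  prv (T2 2) G (has_cheaper P x s y).
Proof.
move=> hP u n; apply: (ExI (t := z)); pls_norm.
have t := neighbor_target hP n.
apply/(AndI (prv_lt_le (target_lt hP t)))/(AndI t).
condition hP 9 [:: x; s; y; z] => /ImpE/(_ n) yz.
apply: prv_cases yz _ _; apply: ImpI; last exact: prv_hyp0.
apply/prv_false/(unsolvable_false hP (prv_weaken1 _ u)).
have zy := prv_eq_sym (@prv_hyp0 (T2 2) G (y == z)%FO).
have := prv_eq_fsubst (A := Nbr P (Var 1) (Var 2) (Var 3) (Var 0))
  (sg := env [:: x; s; y]) zy.
by rewrite /env /=; pls_norm; apply; apply: prv_weaken1.
Qed.

(** For rk(x,s) = 0 the cheaper target is N(x,s,y), and for rk(x,s) > 0 it is
    U(x,s,y,z), where z solves S(x,s,y); the latter is solvable because its rank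
    is smaller. *)
Lemma unsolvable_target P G x s y : nPLS_in (S2 1) P ->
  prv (T2 2) G (Tgt P x s y) -> prv (T2 2) G (unsolvable P x s) ->
  prv (T2 2) G (~ has_lower_unsolvable P x s) ->
  prv (T2 2) G (has_cheaper P x s y).
Proof.
move=> hP t u nlow; pose S := app (gen_source P) [tuple x; s; y].
apply: prv_cases (prv_zero_or_pos _ _ (rk P x s)) _ _; apply: ImpI.
  pose z := app (nbh0 P) [tuple x; s; y].
  apply: (neighbor_cheaper (z := z) hP (prv_weaken1 _ u)).
  condition hP 4 [:: x; s; y; z] => /ImpE/(_ (prv_hyp0 _ _ _))/AndE2/ImpE.
  by apply; apply: AndI (EqRefl _ _ _) (prv_weaken1 _ t).
condition hP 5 [:: x; s; y].
move=> /ImpE/(_ (AndI (prv_hyp0 _ _ _) (prv_weaken1 _ t))) stable_or_lower.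
apply: prv_cases stable_or_lower _ _; apply: ImpI.
  apply/prv_false/(unsolvable_false hP _ (prv_hyp0 _ _ _)).
  exact/prv_weaken1/prv_weaken1.
(* As a hypothesis, the unsolvability of s is shifted with the context when the
   quantifier over z is introduced below. *)
apply: RAA; apply: (prv_cut (A := unsolvable P x s)); first by lift u.
apply: (ImpE (A := has_lower_unsolvable P x s)); first by lift nlow.
match goal with |- prv _ ?G1 _ => have src : prv (T2 2) G1 (Src P x S) end.
  by condition hP 2 [:: x; s; y] => /ImpE; apply; lift t.
apply: (ExI (t := S)); pls_norm.
apply: AndI (prv_lt_le (source_lt hP src)) _; apply: AndI; last by hyp 2.
apply: AndI src _; apply: AllI; apply: ImpI; apply: ImpI.
rewrite /S; pls_norm.
match goal with |- prv _ (Nbr _ ?x1 ?S1 ?z _ :: _) _ =>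
  pose U := app (extract P) [tuple x1; tsubst (wk 1) s; tsubst (wk 1) y; z] end.
hyp 3 => /ImpE; apply; apply: (neighbor_cheaper (z := U) hP); first by hyp 2.
condition hP 6 [:: tsubst (wk 1) x; tsubst (wk 1) s; tsubst (wk 1) y; Var 0].
move=> /ImpE; apply; apply: AndI (prv_hyp0 _ _ _); hyp 5; exact.
Qed.

(** Without an unsolvable source of lower rank, the targets of s would form a
    nonempty set without an element of minimal cost. *)
Lemma unsolvable_descent P G x s : nPLS_in (S2 1) P ->
  prv (T2 2) G (Src P x s) -> prv (T2 2) G (unsolvable P x s) ->
  prv (T2 2) G (has_lower_unsolvable P x s).
Proof.
move=> hP src u; apply: prv_cut src _; apply: prv_cut (prv_weaken1 _ u) _.
apply: RAA.
have sD : Sigmab 2 (Tgt P (tshift x) (tshift s) (Var 0)).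
  exact: (sharply_bounded_Sigmab (sb_Eq _ _) _).1.
apply: (prv_descent (b := vbound P x) (f := cst P (tshift x) (Var 0)) sD).
  apply: (ExI (t := app (init_target P) [tuple x; s])); pls_norm.
  match goal with |- prv _ ?G _ =>
    have t : prv (T2 2) G (Tgt P x s (app (init_target P) [tuple x; s])) end.
    by condition hP 8 [:: x; s] => /ImpE; apply; hyp 2.
  exact: AndI (prv_lt_le (target_lt hP t)) t.
apply: AllI; apply: ImpI; apply: ImpI; pls_norm.
match goal with |- prv _ ?G _ => have := @unsolvable_target P G
  (tsubst (wk 1) x) (tsubst (wk 1) s) (Var 0) hP end.
rewrite /has_cheaper; pls_norm; apply; [hyp 0|hyp 3|hyp 2]; exact.
Qed.

Theorem lemma2 (P : nPLS) (hP : nPLS_in (S2 1) P) :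
  provable (T2 2)
    (let x := Var 1 in let y := Var 0 in
     All (Ex (y < exp_poly_len (bound P) x /\ solves P x y)))%FO.
Proof.
rewrite /provable /=; apply: AllI; apply: RAA => /=.
have sD : Sigmab 2 (Src P (Var 1) (Var 0) /\ unsolvable P (Var 1) (Var 0))%FO.
  apply: Sigmab_And; first exact: (sharply_bounded_Sigmab (sb_Eq _ _) _).1.
  apply/Sigmab_Pi/Pib_bAll/Pib_Not.
  exact: (sharply_bounded_Sigmab (sb_Eq _ _) _).1.
apply: (prv_descent (b := vbound P (Var 0)) (f := rk P (Var 1) (Var 0)) sD).
  pose s := app (init_source P) [tuple Var 0].
  match goal with |- prv _ ?G _ =>
    have src : prv (T2 2) G (Src P (Var 0) s) end.
    by condition hP 7 [:: Var 0].
  apply: (ExI (t := s)); pls_norm.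
  apply/(AndI (prv_lt_le (source_lt hP src)))/(AndI src).
  rewrite /unsolvable; apply: AllI; apply: ImpI; apply: ImpI.
  rewrite /solves; pls_norm.
  hyp 2 => /ImpE; apply; apply: (ExI (t := Var 0)); pls_norm.
  apply: AndI (prv_hyp0 _ _ _).
  exact/(target_lt hP)/(neighbor_target hP)/prv_hyp0.
apply: AllI; apply: ImpI; apply: ImpI; pls_norm.
match goal with |- prv _ ?G _ =>
  have := @unsolvable_descent P G (Var 1) (Var 0) hP end.
rewrite /has_lower_unsolvable; pls_norm.
by apply; hyp 0; [apply: AndE1 | apply: AndE2].
Qed.
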